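(* Let $G=(V,E)$ be a finite connected graph. Then the total number of even orientations of $G$ is equal to $$2^{|E|-|V|}\big(1+(-1)^{|E|}\big).$$
   Context: An orientation of a graph $G=(V,E)$ is an assignment of a direction to each edge $\{u,v\}\in E$. An orientation is called even if the out-degree of every vertex is even (divisible by $2$). *)

(* Defs.v *)
From mathcomp Require Import all_boot all_order all_algebra.

Set Implicit Arguments.
Unset Strict Implicit.
Unset Printing Implicit Defensive.

(* A simple graph on the vertex set T is a symmetric irreflexive adjacency    *)
(* relation e : rel T.                                                        *)
Definition simple_graph (T : finType) (e : rel T) : Prop :=
  symmetric e /\ irreflexive e.

(* The graph without vertices does not count as connected. *)
Definition connected_graph (T : finType) (e : rel T) : Prop :=
  (0 < #|T|)%N /\ forall x y : T, connect e x y.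

Definition edges (T : finType) (e : rel T) : {set {set T}} :=
  [set [set p.1; p.2] | p : T * T & e p.1 p.2].

(* An orientation is encoded by its set D of arcs, where (u, v) \in D means   *)
(* that the edge {u, v} is directed from u to v.                              *)
Definition is_orientation (T : finType) (e : rel T) (D : {set T * T}) : bool :=
  [forall u, forall v, ((u, v) \in D) ==> e u v] &&
  [forall u, forall v, e u v ==> (((u, v) \in D) (+) ((v, u) \in D))].

Definition outdeg (T : finType) (D : {set T * T}) (u : T) : nat :=
  #|[set v | (u, v) \in D]|.

Definition even_orientations (T : finType) (e : rel T) : {set {set T * T}} :=
  [set D | is_orientation e D & [forall u, ~~ odd (outdeg D u)]].

(* Main.v *)
Require Import Defs.
From mathcomp Require Import all_boot all_order all_algebra.

(** The parity condition is detected by a character sum.  For an orientation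
    [D] and a set [S] of vertices, let the sign of [D] along [S] be the product
    over [u] in [S] of [(-1) ^ outdeg u].  Summing the sign over all [S] gives
    the product over all vertices [u] of [1 + (-1) ^ outdeg u], which is
    [2 ^ |V|] when [D] is even and [0] otherwise ([sum_cut_sign]).  Hence
    [2 ^ |V|] times the number of even orientations is the sum of all the signs
    over all pairs [(S, D)], and this sum is now computed by fixing [S].

    If [S] is neither empty nor full, connectedness gives an edge with exactly
    one end in [S].  Reversing this edge is an involution on orientations that
    changes the sign, so [S] contributes nothing ([sum_cut_sign_proper]).  The
    empty set contributes the number of orientations, [2 ^ |E|]
    ([card_orientations]).  The full set contributes [(-1) ^ |E|] times as
    much, as the out-degrees of an orientation add up to [|E|]
    ([card_orientation]).  The total is [2 ^ |E| * (1 + (-1) ^ |E|)]. *)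

Import GRing.Theory Num.Theory.
Local Open Scope ring_scope.

(** * Orientations of a simple graph *)

Section Orientations.

Context {T : finType} {e : rel T} (He : simple_graph e).

Lemma orientationP (D : {set T * T}) :
  reflect ((forall u v, (u, v) \in D -> e u v) /\
           (forall u v, e u v -> ((v, u) \in D) = ((u, v) \notin D)))
          (is_orientation e D).
Proof.
apply: (iffP andP) => [[/forallP sDe /forallP eD] | [sDe eD]]; split.
- by move=> u v; have /forallP/(_ v)/implyP := sDe u.
- move=> u v euv; have /forallP/(_ v)/implyP/(_ euv) := eD u.
  by case: ((u, v) \in D) => //= /negbTE.
- by apply/forallP=> u; apply/forallP=> v; apply/implyP; apply: sDe.
- apply/forallP=> u; apply/forallP=> v; apply/implyP => /eD ->.
  by case: ((u, v) \in D).
Qed.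

(** Forgetting directions is a bijection from the arcs of an orientation to
    the edges: two arcs over the same edge are equal or opposite, and an
    orientation never contains two opposite arcs. *)
Lemma card_orientation (D : {set T * T}) :
  is_orientation e D -> #|D| = #|edges e|.
Proof.
case: He => symE irrE /orientationP[sDe eD].
have -> : edges e = [set [set p.1; p.2] | p in D].
  apply/setP=> E; apply/imsetP/imsetP=> -[[u v] uvP ->]; last first.
    by exists (u, v); rewrite // inE; apply: sDe uvP.
  rewrite inE /= in uvP.
  have [uvD | uvD] := boolP ((u, v) \in D); first by exists (u, v).
  by exists (v, u); rewrite 1?eD //= setUC.
rewrite card_in_imset // => -[a b] [c d] /= abD cdD eq_ends.
have eab := sDe _ _ abD.
have ab: a != b by apply: contraTneq eab => ->; rewrite irrE.
have: a \in [set c; d] by rewrite -eq_ends !inE eqxx.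
have: b \in [set c; d] by rewrite -eq_ends !inE eqxx orbT.
rewrite !inE => /orP[] /eqP bE /orP[] /eqP aE; subst a b => //.
- by rewrite eqxx in ab.
- by rewrite (eD _ _ (sDe _ _ cdD)) cdD in abD.
- by rewrite eqxx in ab.
Qed.

(** Some total order on the vertices is all that is needed to direct every
    edge upwards; the order used is that of the enumeration of [T]. *)
Definition upward : {set T * T} :=
  [set p | e p.1 p.2 && (enum_rank p.1 < enum_rank p.2)%N].

Lemma upward_orientation : is_orientation e upward.
Proof.
case: He => symE irrE.
apply/orientationP; split=> u v; rewrite !inE /=; first by case/andP.
move=> euv; rewrite symE euv /= -leqNgt [RHS]leq_eqVlt.
case: eqP => // eq_rank.
have vu := enum_rank_inj (val_inj eq_rank).
by rewrite vu irrE in euv.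
Qed.

(** Relative to the reference orientation [upward], an orientation amounts to
    the set of edges on which it agrees with the reference, and this set is
    arbitrary. *)
Lemma card_orientations :
  #|[set D | is_orientation e D]| = (2 ^ #|edges e|)%N.
Proof.
case: He => symE irrE.
have [sUe eU] := orientationP _ upward_orientation.
rewrite -(card_orientation _ upward_orientation) -card_powerset.
rewrite -(card_in_imset (f := fun D => D :&: upward)); last first.
  move=> D1 D2; rewrite !inE => /orientationP[sD1 eD1] /orientationP[sD2 eD2].
  move=> /setP eqD; apply/setP=> -[u v].
  have [euv | neuv] := boolP (e u v); last first.
    by rewrite (contraNF (sD1 u v)) // (contraNF (sD2 u v)).
  have [uvU | uvU] := boolP ((u, v) \in upward).
    by have := eqD (u, v); rewrite !in_setI uvU !andbT.
  have vuU : (v, u) \in upward by rewrite eU.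
  have := eqD (v, u).
  by rewrite !in_setI vuU !andbT (eD1 u v) // (eD2 u v) // => /negb_inj.
apply: eq_card => F; rewrite powersetE.
apply/imsetP/idP=> [[D _ ->] | /subsetP sFU]; first exact: subsetIr.
(* [D] follows [upward] on the edges selected by [F], and opposes it on the
   other edges. *)
pose D := [set p | if p \in upward then p \in F else
                   ((p.2, p.1) \in upward) && ((p.2, p.1) \notin F)].
exists D; last first.
  apply/setP=> p; rewrite in_setI inE.
  case: ifPn => [_ | pU]; rewrite ?andbT ?andbF //.
  exact: contraNF (sFU p) pU.
have memD u v : ((u, v) \in D) = if (u, v) \in upward then (u, v) \in F else
    ((v, u) \in upward) && ((v, u) \notin F) by rewrite [LHS]inE.
rewrite inE; apply/orientationP; split=> u v; rewrite !memD.
  case: ifP => [uvU _ | _ /andP[vuU _]]; first exact: sUe uvU.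
  by rewrite symE; apply: sUe vuU.
move=> euv; rewrite (eU u v euv).
by case: ((u, v) \in upward); rewrite /= ?negbK.
Qed.

End Orientations.

(** * Signs along a set of vertices *)

Section Signs.

Context {T : finType}.

Definition cut_sign (S : {set T}) (D : {set T * T}) : rat :=
  \prod_(u in S) (-1) ^+ outdeg D u.

(** Expanding the product of the factors [1 + (-1) ^ outdeg D u], each of
    which is [2] or [0] according to the parity of the out-degree. *)
Lemma sum_cut_sign (D : {set T * T}) :
  \sum_S cut_sign S D = 2 ^+ #|T| *+ [forall u, ~~ odd (outdeg D u)].
Proof.
transitivity (\prod_(u : T) ((-1) ^+ outdeg D u + 1) : rat).
  by rewrite bigA_distr; apply: eq_bigr => S _; rewrite /cut_sign big_mkcond.
have [/forallP evenD | ] := boolP [forall u, ~~ odd (outdeg D u)].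
  rewrite mulr1n -prodr_const; apply: eq_bigr => u _.
  by rewrite -signr_odd (negbTE (evenD u)).
rewrite negb_forall => /existsP[u]; rewrite negbK => odd_u.
by rewrite (bigD1 u) //= -signr_odd odd_u addNr mul0r.
Qed.

(** The out-degrees over [S] together count the arcs that start in [S].  In
    this form the sign is multiplicative in the arcs, so the effect of changing
    some of them can be read off. *)
Lemma cut_sign_arcs (S : {set T}) (D : {set T * T}) :
  cut_sign S D = \prod_(p in D) (-1) ^+ (p.1 \in S).
Proof.
pose F u v : rat := if (u, v) \in D then (-1) ^+ (u \in S) else 1.
rewrite [RHS]big_mkcond (eq_bigr (fun p => F p.1 p.2)); last by case.
rewrite -(pair_bigA _ F) /cut_sign big_mkcond; apply: eq_bigr => u _.
rewrite /F -big_mkcond /= prodr_const /outdeg.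
have -> : #|[pred v | (u, v) \in D]| = #|[set v | (u, v) \in D]|.
  by apply: eq_card => v; rewrite !inE.
by case: (u \in S); rewrite ?expr1n.
Qed.

Lemma cut_sign0 (D : {set T * T}) : cut_sign set0 D = 1.
Proof. by rewrite /cut_sign big_set0. Qed.

Lemma cut_signT (D : {set T * T}) : cut_sign setT D = (-1) ^+ #|D|.
Proof.
by rewrite cut_sign_arcs -prodr_const; apply: eq_bigr => p _; rewrite in_setT.
Qed.

(** Taking the symmetric difference with both arcs between [a] and [b] is an
    involution on all sets of arcs, and on a set that contains exactly one of
    these two arcs it amounts to reversing that arc. *)
Definition reverse (a b : T) (D : {set T * T}) : {set T * T} :=
  [set p | (p \in D) (+) (p \in [set (a, b); (b, a)])].

Lemma reverseK (a b : T) : involutive (reverse a b).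
Proof. by move=> D; apply/setP=> p; rewrite !inE -addbA addbb addbF. Qed.

Lemma reverse_orientation (e : rel T) (He : simple_graph e) (a b : T)
    (D : {set T * T}) :
  e a b -> is_orientation e D -> is_orientation e (reverse a b D).
Proof.
case: He => symE irrE eab /orientationP[sDe eD].
apply/orientationP; split=> u v; rewrite !inE !xpair_eqE.
  have [uvP _ | _] := boolP (((u == a) && (v == b)) || ((u == b) && (v == a))).
    by case/orP: uvP => /andP[/eqP-> /eqP->] //; rewrite symE.
  by rewrite addbF; apply: sDe.
move=> euv; rewrite (eD u v euv) -addNb orbC.
by rewrite ![(v == _) && _]andbC.
Qed.

(** Of the two arcs between [a] and [b], exactly one starts in [S]. *)
Lemma cut_sign_reverse (a b : T) (S : {set T}) (D : {set T * T}) :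
  a \in S -> b \notin S -> cut_sign S (reverse a b D) = - cut_sign S D.
Proof.
move=> aS bS.
have ab : a != b by apply: contraNneq bS => <-.
have signE (A : {set T * T}) :
    cut_sign S A = \prod_p (-1) ^+ ((p \in A) && (p.1 \in S)).
  rewrite cut_sign_arcs big_mkcond; apply: eq_bigr => p _.
  by case: (p \in A).
transitivity (cut_sign S D * cut_sign S [set (a, b); (b, a)]).
  rewrite !signE -big_split; apply: eq_bigr => p _ /=.
  by rewrite inE andb_addl signr_addb.
rewrite [cut_sign S [set _; _]]cut_sign_arcs big_setU1 ?big_set1 /=.
  by rewrite aS (negbTE bS) mulr1 mulrN1.
by rewrite inE xpair_eqE negb_and ab.
Qed.

(** If every edge leaving a vertex of [S] stayed in [S], then [S] would be a
    union of connected components. *)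
Lemma connected_cut_edge (e : rel T) (S : {set T}) :
  symmetric e -> connected_graph e -> S != set0 -> S != setT ->
  exists a b, [/\ e a b, a \in S & b \notin S].
Proof.
move=> symE [_ conE] /set0Pn[x xS] ST.
have [y yS] : exists y, y \notin S.
  apply/existsP; rewrite -negb_forall; apply: contra ST => /forallP allS.
  by apply/eqP/setP=> y; rewrite in_setT allS.
have [/'exists_existsP[a [b /and3P[eab aS bS]]] | noEdge] :=
    boolP [exists a, exists b, [&& e a b, a \in S & b \notin S]].
  by exists a, b.
have clS : closed e (mem S).
  apply: intro_closed => [| a b eab aS]; first exact: sym_connect_sym.
  apply: contraR noEdge => bS; apply/existsP; exists a; apply/existsP; exists b.
  by rewrite eab aS.
by have := closed_connect clS (conE x y); rewrite xS (negbTE yS).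
Qed.

Lemma sum_cut_sign_proper (e : rel T) (S : {set T}) :
  simple_graph e -> connected_graph e -> S != set0 -> S != setT ->
  \sum_(D | is_orientation e D) cut_sign S D = 0.
Proof.
move=> He conE S0 ST.
have [a [b [eab aS bS]]] := connected_cut_edge e S He.1 conE S0 ST.
set total := \sum_(D | _) _.
suff totalN : total = - total.
  have := mulrn_eq0 total 2.
  by rewrite mulr2n {2}totalN subrr eqxx => /esym/eqP.
(* The involution [reverse a b] permutes the orientations and changes the sign
   of every term. *)
rewrite {1}/total (reindex_inj (inv_inj (reverseK a b))) -sumrN.
apply: eq_big => [D | D _]; last exact: cut_sign_reverse.
apply/idP/idP; last exact: reverse_orientation.
by move/(reverse_orientation e He a b _ eab); rewrite reverseK.
Qed.

End Signs.

(** * Counting even orientations *)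

Theorem corollary4p2 (T : finType) (e : rel T)
    (He : simple_graph e) (Hconn : connected_graph e) :
  (#|even_orientations e|)%:R =
    (2 : rat) ^ ((#|edges e|)%:Z - (#|T|)%:Z) * (1 + (-1) ^+ #|edges e|).
Proof.
have two_neq0 : 2 != 0 :> rat by [].
have T0 : set0 != setT :> {set T}.
  by rewrite eq_sym -card_gt0 cardsT; case: Hconn.
rewrite expfzDr // -exprnP -exprnN mulrAC.
apply: (canRL (mulfK _)); first by rewrite expf_neq0.
transitivity (\sum_(D | is_orientation e D) \sum_S cut_sign S D).
  rewrite (eq_bigr _ (fun D _ => sum_cut_sign D)) -sum1_card natr_sum mulr_suml.
  rewrite [LHS]big_mkcond [RHS]big_mkcond; apply: eq_bigr => D _.
  by rewrite !inE mul1r; case: is_orientation; case: [forall u, _].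
rewrite exchange_big (bigD1 set0) // (bigD1 setT) 1?eq_sym //= addrA.
rewrite [X in _ + X]big1 => [|S /andP[S0 ST]]; last first.
  exact: sum_cut_sign_proper.
have cardE (c : rat) :
    \sum_(D | is_orientation e D) c = 2 ^+ #|edges e| * c.
  rewrite -natrX -(card_orientations He) mulr_natl -sumr_const.
  by apply: eq_bigl => D; rewrite inE.
rewrite (eq_bigr _ (fun D _ => cut_sign0 D)) cardE.
rewrite (eq_bigr (fun=> (-1) ^+ #|edges e|)) => [|D oD]; last first.
  by rewrite cut_signT (card_orientation He).
by rewrite cardE addr0 mulrDr.
Qed.
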